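(* Let $d$ be a positive integer and let $\mathcal{P}$ be a $d$-dimensional convex lattice polytope with Ehrhart polynomial $L_{\mathcal{P}}(t)=L_0+L_1t+\dots+L_dt^d$ (so $L_0=1$). Let $c_0=(-1)^{d+1}d$ and, for $1\le k\le d$, let $$c_k=\begin{cases}(-1)^{d+1}(2^k-1-d), & k\text{ odd},\\ (-1)^{d}(2^k-1-d), & k\text{ even}.\end{cases}$$ Then $$c_0L_0+c_1L_1+\dots+c_dL_d\geq0.$$
   Context: A lattice polytope is a convex polytope whose vertices lie in $\mathbb{Z}^d\subset\mathbb{R}^d$; $L_{\mathcal{P}}(t)$ is the number of points of $\mathbb{Z}^d$ in the dilate $t\mathcal{P}$, which is a polynomial in $t$ of degree $d$ (the Ehrhart polynomial). *)

(* Defs.v *)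
From HB Require Import structures.
From mathcomp Require Import all_boot all_order all_algebra.
From mathcomp Require Import finmap boolp classical_sets cardinality reals.

Set Implicit Arguments.
Unset Strict Implicit.
Unset Printing Implicit Defensive.

Import Order.TTheory GRing.Theory Num.Theory.

Local Open Scope classical_set_scope.
Local Open Scope ring_scope.

Section Polytopes.
Variables (R : realType) (d : nat).
Implicit Types (P V : set 'rV[R]_d) (x : 'rV[R]_d).

Definition convex_hull V : set 'rV[R]_d :=
  [set x | exists (n : nat) (v : 'I_n -> 'rV[R]_d) (a : 'I_n -> R),
     [/\ forall i, V (v i), forall i, 0 <= a i, \sum_i a i = 1 &
         x = \sum_i a i *: v i]].

Definition affine_hull V : set 'rV[R]_d :=
  [set x | exists (n : nat) (v : 'I_n -> 'rV[R]_d) (a : 'I_n -> R),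
     [/\ forall i, V (v i), \sum_i a i = 1 & x = \sum_i a i *: v i]].

Definition convex_polytope P : Prop :=
  exists2 V : set 'rV[R]_d, finite_set V & P = convex_hull V.

(* The vertices of a convex polytope are its extreme points. *)
Definition is_vertex P x : Prop :=
  P x /\ forall (y z : 'rV[R]_d) (s : R), P y -> P z -> 0 < s < 1 ->
    x = s *: y + (1 - s) *: z -> y = x /\ z = x.

Definition real_point (z : 'rV[int]_d) : 'rV[R]_d := map_mx intr z.

Definition lattice_polytope P : Prop :=
  convex_polytope P /\ forall x, is_vertex P x -> range real_point x.

(* The dimension of P is that of its affine hull, a translate p + U of a
   linear subspace U. *)
Definition has_dim P (n : nat) : Prop :=
  exists (p : 'rV[R]_d) (U : {vspace 'rV[R]_d}),
    affine_hull P = [set p + u | u in [set` U]] /\ \dim U = n.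

Definition dilate (t : nat) P : set 'rV[R]_d := [set t%:R *: x | x in P].

(* [fset_set A] enumerates A when A is finite, which is the case here as soon
   as P is bounded; it would be empty for infinite A. *)
Definition lattice_count P (t : nat) : nat :=
  #|` fset_set [set z : 'rV[int]_d | dilate t P (real_point z)]|%fset.

(* At most one polynomial L satisfies this, as it is prescribed at infinitely
   many points. *)
Definition ehrhart_polynomial P (L : {poly R}) : Prop :=
  forall t : nat, (0 < t)%N -> L.[t%:R] = (lattice_count P t)%:R.

End Polytopes.

Definition ehrhart_ineq_coef (R : realType) (d k : nat) : R :=
  if k == 0%N then (-1) ^+ d.+1 * d%:R
  else if odd k then (-1) ^+ d.+1 * (2 ^+ k - 1 - d%:R)
  else (-1) ^+ d * (2 ^+ k - 1 - d%:R).

(* Main.v *)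
(* Since c_k = (-1)^(d+k) (2^k - (d+1)), the sum equals
   (-1)^d (L(-2) - (d+1) L(-1)), which is the coefficient h*_(d-1) of the
   Ehrhart series. Its nonnegativity (Stanley) is shown by counting. In the cone
   over P, a generic cost w on the lattice generators v_i of P selects a regular
   triangulation, and a generic point q of the cone makes its cells half-open,
   so that every lattice point of the cone lies in exactly one of them. In a
   half-open cell, applying the backward difference (f(t) - f(t-1)) once for
   each of the d+1 generators leaves the number of lattice points at height t in
   a half-open parallelepiped; this is nonnegative, and 0 for t > d. Hence the
   (d+1)-st difference of t |-> #(tP), which is h*_t, vanishes for t > d; this
   determines the polynomial L at 0, -1 and -2 from it. *)

Require Import Defs.
From mathcomp Require Import all_boot all_order all_algebra.
From mathcomp Require Import finmap boolp classical_sets cardinality reals.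
From mathcomp Require Import zify ring lra.

Set Implicit Arguments.
Unset Strict Implicit.
Unset Printing Implicit Defensive.

Import Order.TTheory GRing.Theory Num.Theory.
Local Open Scope ring_scope.

(** * Finitely many conditions met at once: small bounds and generic parameters *)

Lemma positive_lower_bound (R : realType) (I : finType) (F : I -> R) :
  (forall i, 0 < F i) -> exists2 e, 0 < e & forall i, e < F i.
Proof.
(* The added 1 makes the bound strict, and the witness positive even for empty [I]. *)
move=> F0; exists ((\sum_i (F i)^-1 + 1)^-1).
  by rewrite invr_gt0 ltr_wpDl // sumr_ge0 // => i _; rewrite invr_ge0 ltW.
move=> i; rewrite -[ltRHS]invrK ltf_pV2 ?posrE ?invr_gt0 //; last first.
  by rewrite ltr_wpDl // sumr_ge0 // => j _; rewrite invr_ge0 ltW.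
rewrite (bigD1 i) //= -addrA ltrDl ltr_wpDl // sumr_ge0 // => j _.
by rewrite invr_ge0 ltW.
Qed.

(** The product of the [F i] is nonzero, so it has fewer than [size p] roots and cannot vanish at
    all of 1, ..., [size p]. *)
Lemma common_nonroot (R : realType) (I : finType) (F : I -> {poly R}) :
  (forall i, F i != 0) -> exists2 s, 0 < s & forall i, (F i).[s] != 0.
Proof.
move=> F0; pose p := \prod_i F i.
have p0 : p != 0 by apply/prodf_neq0 => i _.
pose rs := [seq k.+1%:R : R | k <- iota 0 (size p)].
have /allPn[_ /mapP[k _ ->]] : ~~ all (root p) rs.
  apply/negP => prs; have : uniq rs.
    rewrite map_inj_uniq ?iota_uniq // => i j /eqP.
    by rewrite eqr_nat => /eqP[].
  by move/(max_poly_roots p0 prs); rewrite size_map size_iota ltnn.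
rewrite /root horner_prod => /prodf_neq0 ks.
by exists k.+1%:R => // i; apply: ks.
Qed.

Lemma horner_rVpoly_sum (R : realType) n (u : 'rV[R]_n) (s : R) :
  (rVpoly u).[s] = (u *m \col_i s ^+ i) 0 0.
Proof.
rewrite /rVpoly horner_poly mxE; apply: eq_bigr => i _.
by rewrite valK mxE.
Qed.

(** * Triangulating a cone by a generic cost *)

Section Bases.
Variables (R : realType) (m n : nat) (V : 'M[R]_(m, n)) (h : 'cV[R]_n).
Hypothesis Vh : V *m h = const_mx 1.
Hypothesis V_full : row_full V.
Implicit Types (S : {set 'I_m}) (r a : 'rV[R]_m) (x : 'rV[R]_n) (w : 'cV[R]_m).

Definition supported S r := forall i, i \notin S -> r 0 i = 0.

Definition independent S :=
  forall r, supported S r -> r *m V = 0 -> r = 0.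

(** Masking rows instead of extracting a submatrix keeps all matrix shapes independent of [S]. *)
Definition select S : 'M[R]_m := diag_mx (\row_i (i \in S)%:R).

(* When [S] indexes a basis, [x *m coords S] is the coordinate vector of [x] in
   it, padded with zeros outside [S]. *)
Definition coords S : 'M[R]_(n, m) := pinvmx (select S *m V) *m select S.

(** The first identity says that the rows of [V] in [S] span, the second that they are
    independent. *)
Definition is_basis S :=
  (coords S *m V == 1%:M) && (select S *m V *m coords S == select S).

Lemma mul_selectE S r i : (r *m select S) 0 i = r 0 i * (i \in S)%:R.
Proof. by rewrite mul_mx_diag !mxE. Qed.

Lemma mul_select S r : supported S r -> r *m select S = r.
Proof.
move=> rS; apply/rowP => i; rewrite mul_selectE.
by have [_|/rS->] := boolP (i \in S); rewrite ?mulr1 ?mul0r.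
Qed.

Lemma coords_supported S x : supported S (x *m coords S).
Proof. by move=> i /negPf iS; rewrite mulmxA mul_selectE iS mulr0. Qed.

Lemma select_supported S i : supported S (row i (select S)).
Proof.
by move=> j /negPf jS; rewrite !mxE; case: eqP => // ->; rewrite jS.
Qed.

Lemma coordsK S x : is_basis S -> x *m coords S *m V = x.
Proof. by case/andP => /eqP E _; rewrite -mulmxA E mulmx1. Qed.

Lemma basis_coordsE S r : is_basis S -> supported S r -> r *m V *m coords S = r.
Proof.
case/andP => _ /eqP E rS; rewrite -[in LHS](mul_select rS) -2!mulmxA.
by rewrite (mulmxA (select S)) E mul_select.
Qed.

Lemma basis_row S i : is_basis S -> i \in S ->
  row i V *m coords S = delta_mx 0 i.
Proof.
move=> bS iS; rewrite rowE basis_coordsE // => j jS; rewrite mxE /=.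
by case: eqP jS => // ->; rewrite iS.
Qed.

Lemma coords_subr S x i j : is_basis S -> i \in S ->
  ((x - row i V) *m coords S) 0 j = (x *m coords S) 0 j - (j == i)%:R.
Proof. by move=> bS iS; rewrite mulmxBl basis_row // !mxE. Qed.

(** Cyclicity of the trace: the identity of size [n] and the projector [select S] have the same
    trace. *)
Lemma card_basis S : is_basis S -> #|S| = n.
Proof.
case/andP=> /eqP E1 /eqP E2; apply/eqP; rewrite -(eqr_nat R); apply/eqP.
have <- : \tr (1%:M : 'M[R]_n) = n%:R by rewrite mxtrace1.
rewrite -E1 mxtrace_mulC.
have -> : coords S = coords S *m select S.
  apply/row_matrixP=> i; rewrite [RHS]row_mul mul_select //.
  by move=> j jS; rewrite rowE coords_supported.
rewrite mulmxA mxtrace_mulC mulmxA E2 mxtrace_diag.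
under eq_bigr do rewrite mxE.
by rewrite -natr_sum -sum1_card big_mkcond.
Qed.

Lemma basisI S : independent S ->
  (forall x, exists2 r, supported S r & r *m V = x) -> is_basis S.
Proof.
move=> iS fS.
have E : coords S *m V = 1%:M.
  rewrite -mulmxA -[pinvmx _]mul1mx mulmxKpV //; apply/row_subP => i.
  have [r rS <-] := fS (row i 1%:M).
  by rewrite -(mul_select rS) -mulmxA submxMl.
rewrite /is_basis E eqxx; apply/eqP/row_matrixP => i.
apply/eqP; rewrite -subr_eq0; apply/eqP/iS.
  move=> j jS; rewrite row_mul mxE (coords_supported _ jS) mxE.
  by rewrite (select_supported _ jS) subrr.
by rewrite mulmxBl -!row_mul -(mulmxA _ (coords S)) E mulmx1 subrr.
Qed.

(** An inclusion-maximal independent superset spans: a row outside its span could still be added. *)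
Lemma independent_basis S : independent S ->
  exists2 B : {set 'I_m}, S \subset B & is_basis B.
Proof.
move=> iS.
pose ind (B : {set 'I_m}) := `[< independent B >].
have [B /maxsetP[/asboolP iB maxB] SB] : {B : {set 'I_m} | maxset ind B & S \subset B}.
  by apply: maxset_exists; apply/asboolP.
exists B => //; apply: basisI => //.
have span k : exists2 r, supported B r & r *m V = row k V.
  have [kB|kB] := boolP (k \in B).
    exists (delta_mx 0 k); last by rewrite -rowE.
    by move=> j jB; rewrite mxE /=; case: eqP jB => // ->; rewrite kB.
  apply: contrapT => nspan.
  have /maxB /(_ (finset.subsetUr _ _)) : ind (k |: B).
    apply/asboolP => r rkB rV0.
    have [rk0|rk0] := eqVneq (r 0 k) 0.
      apply: iB => // j jB; have [->//|jk] := eqVneq j k.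
      by apply: rkB; rewrite !inE negb_or jk.
    (* The relation [r], solved for row [k], writes that row over [B]. *)
    case: nspan; exists (delta_mx 0 k - (r 0 k)^-1 *: r).
      move=> j jB; rewrite !mxE /=; have [->|jk] := eqVneq j k.
        by rewrite mulVf ?subrr.
      by rewrite (rkB j) ?mulr0 ?subr0 // !inE negb_or jk.
    by rewrite mulmxBl -rowE -scalemxAl rV0 scaler0 subr0.
  by move=> /setP/(_ k); rewrite !inE eqxx (negPf kB).
move=> x; have /submxP[r ->] : (x <= V)%MS by apply: submx_full.
have [f fP] : {f : 'I_m -> 'rV[R]_m & forall k, supported B (f k) /\ f k *m V = row k V}.
  apply: (@choice _ _ (fun k r => supported B r /\ r *m V = row k V)) => k.
  by have [u] := span k; exists u.
exists (\sum_k r 0 k *: f k).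
  move=> j jB; rewrite summxE big1 // => k _.
  by rewrite mxE (proj1 (fP k)) ?mulr0.
rewrite mulmx_suml mulmx_sum_row; apply: eq_bigr => k _.
by rewrite -scalemxAl (proj2 (fP k)).
Qed.

(** All rows of [V] have height 1 under [h]. Hence a nonzero relation has a negative entry, which
    bounds the moves in [shrink_support]. *)
Lemma relation_sum r : r *m V = 0 -> \sum_i r 0 i = 0.
Proof.
move=> rV; have /matrixP/(_ 0 0) : r *m (V *m h) = 0 by rewrite mulmxA rV mul0mx.
rewrite Vh !mxE => rV1; rewrite -[RHS]rV1.
by apply: eq_bigr => i _; rewrite mxE mulr1.
Qed.

(** Ratio test: move from [a] along [r] until a first coordinate reaches 0. Coordinate [i] with
    [r 0 i < 0] does so at time [F i], and the smallest such time is taken. *)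
Lemma shrink_support a r : (forall i, 0 <= a 0 i) ->
  supported [set i | a 0 i != 0] r -> r *m V = 0 -> r != 0 ->
  exists t, [/\ 0 <= t, forall i, 0 <= (a + t *: r) 0 i &
    [set i | (a + t *: r) 0 i != 0] \proper [set i | a 0 i != 0]].
Proof.
move=> a0 ra rV r0.
have [i0 ri0] : exists i, r 0 i < 0.
  apply: contrapT => nr; case/eqP: r0; apply/rowP => i; rewrite mxE.
  have rge0 j : 0 <= r 0 j by rewrite leNgt; apply/negP => rj; apply: nr; exists j.
  apply/eqP; move/eqP: (relation_sum rV); rewrite psumr_eq0 //.
  by move/allP/(_ i (mem_index_enum i)).
pose F i := - a 0 i / r 0 i.
case: (@arg_minP _ _ _ i0 (fun i => r 0 i < 0) F ri0) => i ri Fi.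
have Fi0 : 0 <= F i by rewrite /F mulNr oppr_ge0 mulr_ge0_le0 ?invr_le0 // ltW.
exists (F i); split => //.
- move=> j; rewrite !mxE; have [rj|rj] := ltP (r 0 j) 0; last first.
    exact: addr_ge0 (a0 j) (mulr_ge0 Fi0 rj).
  have := Fi j rj; rewrite {2}/F ler_ndivlMr // => H.
  by rewrite -lerBlDl sub0r.
- apply/fintype.properP; split.
    apply/fintype.subsetP => j; rewrite !inE !mxE; apply: contra => /eqP aj.
    by rewrite ra ?inE aj ?eqxx // mulr0 addr0.
  exists i; rewrite !inE.
    by apply/negP => /eqP ai; move: ri; rewrite ra ?ltxx // inE ai eqxx.
  by rewrite !mxE /F mulfVK ?subrr ?eqxx // lt_eqF.
Qed.

(* Carathéodory's theorem, keeping track of a cost [w]. *)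
Lemma basic_solution w a : (forall i, 0 <= a 0 i) ->
  exists S, [/\ is_basis S, forall i, 0 <= (a *m V *m coords S) 0 i &
    (a *m V *m coords S *m w) 0 0 <= (a *m w) 0 0].
Proof.
have [k] := ubnP #|[set i | a 0 i != 0]|; elim: k a => // k IH a ka a0.
have [ia|] := pselect (independent [set i | a 0 i != 0]).
  have [B aB bB] := independent_basis ia.
  have aBs : supported B a.
    move=> i; apply: contraNeq => ai.
    by apply: (fintype.subsetP aB); rewrite inE.
  by exists B; rewrite basis_coordsE.
move=> /existsNP[r /not_implyP[ra /not_implyP[rV /eqP r0]]].
(* One of [r] and [-r] does not raise the cost. *)
wlog rw : r ra rV r0 / (r *m w) 0 0 <= 0.
  move=> H; have [|rw] := leP ((r *m w) 0 0) 0; first exact: H.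
  apply: (H (- r)); rewrite ?mulNmx ?rV ?oppr0 ?oppr_eq0 //.
    by move=> i /ra; rewrite mxE => ->; rewrite oppr0.
  by rewrite mxE oppr_le0 ltW.
have [t [t0 at0 tprop]] := shrink_support a0 ra rV r0.
have [|S [bS]] := IH _ _ at0.
  by rewrite -ltnS (leq_trans _ ka) // ltnS; apply: proper_card.
have -> : (a + t *: r) *m V = a *m V.
  by rewrite mulmxDl -scalemxAl rV scaler0 addr0.
move=> S0 Sw; exists S; split=> //; apply: le_trans Sw _.
rewrite mulmxDl -scalemxAl mxE [X in _ + X]mxE gerDl.
exact: mulr_ge0_le0.
Qed.


(** Take [w] on the moment curve, with entries [s ^+ i]: each condition says that [s] is not a root
    of a polynomial, nonzero because its coefficient at [k] is 1. This [w] serves twice, as heights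
    of a triangulation and as weights of a generic point [w^T *m V] of the cone. *)
Lemma generic_cost : exists w : 'cV[R]_m, [/\ forall i, 0 < w i 0,
  forall S k, is_basis S -> k \notin S ->
    (row k V *m coords S *m w) 0 0 != w k 0 &
  forall S i, is_basis S -> i \in S -> (w^T *m V *m coords S) 0 i != 0].
Proof.
pose F (Sk : {set 'I_m} * 'I_m) : {poly R} :=
  if ~~ is_basis Sk.1 then 1 else
  if Sk.2 \in Sk.1 then rVpoly (col Sk.2 (V *m coords Sk.1))^T
  else rVpoly (delta_mx 0 Sk.2 - row Sk.2 V *m coords Sk.1).
have [|s s0 sF] := @common_nonroot _ _ F.
  case=> S k; rewrite /F /=; case: ifPn => [_|/negPn bS]; first exact: oner_neq0.
  case: ifPn => kS; apply: contraTneq (oner_neq0 R) => /(congr1 (fun p : {poly R} => p`_k)).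
    rewrite coef_rVpoly_ord coef0 2!mxE => E; rewrite -E negbK.
    have := congr1 (fun M : 'rV[R]_m => M 0 k) (basis_row bS kS).
    by rewrite -row_mul !mxE /= eqxx => ->.
  rewrite coef_rVpoly_ord coef0 mxE [X in _ + X]mxE (coords_supported _ kS) mxE.
  by rewrite !eqxx subr0 negbK => /eqP.
exists (\col_i s ^+ i); split.
- by move=> i; rewrite mxE exprn_gt0.
- move=> S k bS kS; have := sF (S, k); rewrite /F bS (negPf kS) /=.
  rewrite horner_rVpoly_sum; set w := \col_i _.
  by rewrite mulmxBl mxE -rowE [X in _ + X]mxE subr_eq0 eq_sym [row k w 0 0]mxE.
- move=> S i bS iS; have := sF (S, i); rewrite /F bS iS /=.
  rewrite horner_rVpoly_sum -mulmxA !mxE; apply: contra => /eqP E; apply/eqP.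
  by rewrite -[RHS]E; apply: eq_bigr => j _; rewrite !mxE mulrC.
Qed.

(** * The regular triangulation and its half-open cells *)

Section Triangulation.
Variables (w : 'cV[R]_m) (q : 'rV[R]_n).
Hypothesis w_generic : forall S k, is_basis S -> k \notin S ->
  (row k V *m coords S *m w) 0 0 != w k 0.
Hypothesis q_generic : forall S i, is_basis S -> i \in S -> (q *m coords S) 0 i != 0.
Hypothesis q_cone : exists2 u : 'rV[R]_m, (forall i, 0 <= u 0 i) & u *m V = q.

(* The simplices of the regular triangulation induced by the heights [w]: those
   whose reduced costs are all positive. *)
Definition cell S :=
  is_basis S && [forall (k | k \notin S), (row k V *m coords S *m w) 0 0 < w k 0].

(* The [i]-th coordinate of [x + e q] is positive for small [e > 0]. *)
Definition inside S i x := (0 < (x *m coords S) 0 i)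
  || ((x *m coords S) 0 i == 0) && (0 < (q *m coords S) 0 i).

Lemma inside_ge0 S i x : inside S i x -> 0 <= (x *m coords S) 0 i.
Proof. by case/orP => [/ltW//|/andP[/eqP-> _]]. Qed.

(** A single [e] serves all bases and coordinates. If [e * |b| < |a|], adding [e * b] does not
    change the sign of a nonzero [a]; if [a = 0], the sign is that of [b], nonzero by genericity of
    [q]. *)
Lemma inside_perturb x : exists2 e, 0 < e & forall S i, is_basis S -> i \in S ->
  ((x + e *: q) *m coords S) 0 i != 0 /\
  (0 < ((x + e *: q) *m coords S) 0 i) = inside S i x.
Proof.
pose a (Si : {set 'I_m} * 'I_m) := (x *m coords Si.1) 0 Si.2.
pose b (Si : {set 'I_m} * 'I_m) := (q *m coords Si.1) 0 Si.2.
pose F Si := if (a Si == 0) || (b Si == 0) then 1 else `|a Si| / `|b Si|.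
have [|e e0 eF] := @positive_lower_bound _ _ F.
  by move=> Si; rewrite /F; case: ifPn => // /norP[a0 b0]; rewrite divr_gt0 ?normr_gt0.
exists e => // S i bS iS; rewrite mulmxDl -scalemxAl mxE [X in _ + X]mxE /inside.
have {eF} := eF (S, i); have := q_generic bS iS; rewrite /F /a /b /=.
move: {F} ((x *m _) 0 i) ((q *m _) 0 i) => {}a {}b b0; rewrite (negPf b0) orbF.
have [->|a0] := eqVneq a 0.
  by rewrite add0r ltxx /= pmulr_rgt0 // mulf_neq0 // gt_eqF.
rewrite orbF ltr_pdivlMr ?normr_gt0 // -{1}(gtr0_norm e0) -normrM.
rewrite ltr_norml => /andP[].
move: (e * b) => c.
have [a1|a1] := ltrP 0 a; rewrite ?(gtr0_norm a1) ?(ler0_norm a1) => c1 c2.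
  have H : 0 < a + c by lra.
  by rewrite H gt_eqF.
have H : a + c < 0 by lra.
by rewrite lt_eqF // ltNge (ltW H).
Qed.

(** Reduced costs of linear programming: rewriting [r] over [S] saves, for each generator outside
    [S], its weight times its reduced cost; generators in [S] have reduced cost 0. *)
Lemma cell_price S r : cell S -> (r *m V *m coords S *m w) 0 0 =
  (r *m w) 0 0 - \sum_(k | k \notin S) r 0 k * (w k 0 - (row k V *m coords S *m w) 0 0).
Proof.
move=> /andP[bS _]; pose M := V *m coords S *m w.
have Mk k : (row k V *m coords S *m w) 0 0 = M k 0 by rewrite -2!row_mul mxE.
have MS k : k \in S -> M k 0 = w k 0.
  by move=> kS; rewrite -Mk basis_row // -rowE mxE.
have -> : r *m V *m coords S *m w = r *m M by rewrite !mulmxA.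
under [X in _ = _ - X]eq_bigr do rewrite Mk.
rewrite [LHS]mxE [(r *m w) 0 0]mxE.
rewrite (bigID (mem S)) /= [X in _ = X - _](bigID (mem S)) /= -addrA -sumrB.
congr (_ + _); apply: eq_bigr => k kS; first by rewrite MS.
by rewrite mulrBr subKr.
Qed.

(** Both cells price the perturbed point. By [cell_price], a cell [A] prices it no higher than [B]
    does, with equality only if [B \subset A], since its coordinates over [B] are positive.
    Exchanging the roles gives equality. *)
Lemma cell_unique S S' x : cell S -> cell S' ->
  (forall i, i \in S -> inside S i x) -> (forall i, i \in S' -> inside S' i x) ->
  S = S'.
Proof.
move=> cS cS' Sx S'x; have [e e0 He] := inside_perturb x.
have sub A B : cell A -> cell B ->
    (forall i, i \in A -> inside A i x) -> (forall i, i \in B -> inside B i x) ->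
    ((x + e *: q) *m coords A *m w) 0 0 <= ((x + e *: q) *m coords B *m w) 0 0 ?= iff (B \subset A).
  move=> cA cB Ax Bx.
  have [bA /forall_inP Aw] := andP cA; have [bB _] := andP cB.
  rewrite -{1}(coordsK (x + e *: q) bB) (cell_price _ cA).
  set y := (x + e *: q) *m coords B.
  have y0 k : 0 <= y 0 k.
    have [kB|kB] := boolP (k \in B); last by rewrite coords_supported.
    by rewrite ltW // (He _ _ bB kB).2 Bx.
  have t0 k : k \notin A -> 0 <= y 0 k * (w k 0 - (row k V *m coords A *m w) 0 0).
    by move=> kA; rewrite mulr_ge0 // subr_ge0 ltW // Aw.
  split; first by rewrite gerBl sumr_ge0.
  rewrite -subr_eq0 addrAC subrr add0r oppr_eq0 psumr_eq0 //.
  apply/allP/fintype.subsetP => [H k kB|BA k _].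
    apply: contraTT (H k (mem_index_enum k)) => kA; rewrite kA /=.
    rewrite mulf_neq0 //; first by case: (He _ _ bB kB).
    by rewrite gt_eqF // subr_gt0 Aw.
  apply/implyP => kA; rewrite [y 0 k](coords_supported _ (contra _ kA)) ?mul0r //.
  exact: BA.
have H1 := sub _ _ cS cS' Sx S'x; have H2 := sub _ _ cS' cS S'x Sx.
have E : ((x + e *: q) *m coords S *m w) 0 0 = ((x + e *: q) *m coords S' *m w) 0 0.
  by apply/le_anti; rewrite H1 H2.
apply/eqP; rewrite finset.eqEsubset.
by move: (H1.2) (H2.2); rewrite E eqxx => <- <-.
Qed.

(** Among the bases giving the perturbed point nonnegative coordinates, take a cheapest one. Were it
    not a cell, bringing in a generator of negative reduced cost would lower the cost, and
    [basic_solution] would yield a cheaper basis. *)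
Lemma cell_exists a x : (forall i, 0 <= a 0 i) -> a *m V = x ->
  exists2 S, cell S & forall i, i \in S -> inside S i x.
Proof.
move=> a0 ax; have [e e0 He] := inside_perturb x.
have [u u0 uq] := q_cone.
pose x' := x + e *: q; pose a' := a + e *: u.
have a'0 i : 0 <= a' 0 i by rewrite !mxE addr_ge0 // mulr_ge0 // ltW.
have a'V : a' *m V = x' by rewrite mulmxDl -scalemxAl ax uq.
have [S0 [bS0 S00 _]] := basic_solution w a'0.
pose good (S : {set 'I_m}) := is_basis S && [forall i, 0 <= (x' *m coords S) 0 i].
have gS0 : good S0 by rewrite /good bS0 -a'V; apply/forallP.
case: (@arg_minP _ _ _ S0 good (fun S => (x' *m coords S *m w) 0 0) gS0).
move=> S /andP[bS /forallP S_ge0] Smin.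
have Sx i : i \in S -> inside S i x.
  by move=> iS; case: (He _ _ bS iS) => H <-; rewrite lt_def H S_ge0.
exists S => //; rewrite /cell bS /=; apply/forall_inP => k kS.
rewrite ltNge le_eqVlt eq_sym (negPf (w_generic bS kS)) /=; apply/negP => kw.
pose y := x' *m coords S; pose r := delta_mx 0 k - row k V *m coords S.
have rV : r *m V = 0 by rewrite mulmxBl -rowE coordsK // subrr.
(* Moving by [t] below [F i] keeps coordinate [i] nonnegative on [S]; the added 1 avoids a zero
   denominator. Outside [S], [t > 0] is enough. *)
pose F i := if i \in S then y 0 i / (`|r 0 i| + 1) else 1.
have [|t t0 tF] := @positive_lower_bound _ _ F.
  move=> i; rewrite /F; case: ifPn => // iS.
  rewrite divr_gt0 ?ltr_wpDl //.
  by rewrite lt_def S_ge0 andbT; case: (He _ _ bS iS).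
have b0 i : 0 <= (y + t *: r) 0 i.
  rewrite mxE [X in _ + X]mxE; have [iS|iS] := boolP (i \in S); last first.
    rewrite [y 0 i](coords_supported _ iS) add0r mulr_ge0 ?(ltW t0) //.
    by rewrite mxE [X in _ + X]mxE (coords_supported _ iS) subr0 mxE ler0n.
  have := tF i; rewrite /F iS ltr_pdivlMr ?ltr_wpDl // => H.
  have : t * - r 0 i <= t * (`|r 0 i| + 1).
    rewrite ler_pM2l // (le_trans (ler_norm _)) // normrN lerDl; exact: ler01.
  by rewrite mulrN; lra.
have [S' [bS' S'0 S'w]] := basic_solution w b0.
have E : (y + t *: r) *m V = x'.
  by rewrite mulmxDl -scalemxAl rV scaler0 addr0 coordsK.
rewrite E in S'0 S'w.
have gS' : good S' by rewrite /good bS'; apply/forallP.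
have := le_trans (Smin _ gS') S'w; rewrite leNgt => /negP; apply.
rewrite mulmxDl -scalemxAl mxE [X in _ + X]mxE gtrDl pmulr_rlt0 //.
by rewrite mulmxBl -rowE mxE [X in _ + X]mxE mxE subr_lt0.
Qed.

End Triangulation.

End Bases.

(** * Backward differences *)

Section BackwardDifference.
Variable R : realType.
Implicit Types (f g : int -> R) (p : {poly R}).

Definition backward_diff f (t : int) : R := f t - f (t - 1).

Lemma iter_backward_diffB k f g t :
  iter k backward_diff (fun s => f s - g s) t =
  iter k backward_diff f t - iter k backward_diff g t.
Proof.
elim: k t => //= k IH t; rewrite /backward_diff !IH; ring.
Qed.

(** The iterated difference is the alternating binomial sum of the [g (t - i)]. As [g] vanishes
    above [s], only [i = k] survives at [s + k], and only [i = k - 1] and [i = k] at [s + k - 1]. *)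
Lemma iter_backward_diff_top k g (s : int) :
  (forall t, s < t -> g t = 0) ->
  [/\ forall t, s + k%:Z < t -> iter k backward_diff g t = 0,
      iter k backward_diff g (s + k%:Z) = (-1) ^+ k * g s &
      iter k backward_diff g (s + k%:Z - 1) =
        (-1) ^+ k * g (s - 1) - (-1) ^+ k * k%:R * g s].
Proof.
move=> g0; elim: k => [|k [IH0 IH1 IH2]] /=.
  rewrite addr0; split=> //; first by rewrite mul1r.
  by rewrite mulr0 mul0r subr0 mul1r.
have E : s + k.+1%:Z - 1 = s + k%:Z by rewrite -addn1 PoszD; ring.
rewrite /backward_diff; split.
- by move=> t st; rewrite !IH0 ?subrr //; lia.
- by rewrite E IH0 ?IH1 ?exprS; [ring|lia].
- by rewrite E IH1 IH2 exprS -natr1; ring.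
Qed.

Definition poly_backward_diff p : {poly R} := p - (p \Po ('X - 1)).

Lemma horner_poly_backward_diff k p (t : int) :
  (iter k poly_backward_diff p).[t%:~R] =
  iter k backward_diff (fun s => p.[s%:~R]) t.
Proof.
elim: k t => //= k IH t.
rewrite /poly_backward_diff /backward_diff -!IH hornerD hornerN horner_comp.
by rewrite !hornerE rmorphB.
Qed.

(** By Taylor expansion at -1 the difference is [p'] plus terms of lower degree, and in
    characteristic 0 the degree of [p'] is only one less than that of [p]. *)
Lemma size_poly_backward_diff p :
  (size p <= (size (poly_backward_diff p)).+1)%N.
Proof.
have [|p1] := leqP (size p) 1; first by move/leq_trans; apply.
case sp : (size p) p1 => [|[|k]] // _.
rewrite ltnNge; apply/negP => /leq_sizeP/(_ k (leqnn _)) /eqP; apply/negP.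
rewrite /poly_backward_diff; have -> : p \Po ('X - 1) = \sum_(i < size p) p^`N(i) * (-1) ^+ i.
  rewrite /comp_poly nderiv_taylor; last exact: mulrC.
  rewrite size_map_polyC; apply: eq_bigr => i _.
  by rewrite nderivn_map -[X in X * _]/(p^`N(i) \Po 'X) comp_polyXr.
rewrite sp 2!big_ord_recl /= nderivn0 nderivn1 mulr1 opprD addNKr.
rewrite expr1 mulrN1 opprD opprK coefD coefN coef_deriv coef_sum big1 ?subr0.
  rewrite mulrn_eq0 negb_or /= -[k.+1]/(k.+2.-1) -sp -lead_coefE lead_coef_eq0.
  by rewrite -size_poly_eq0 sp.
move=> i _; rewrite -polyC1 -polyCN -polyC_exp coefMC coef_nderivn nth_default ?mul0rn ?mul0r //.
by rewrite sp /bump /=; lia.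
Qed.

Lemma size_iter_poly_backward_diff k p :
  iter k poly_backward_diff p = 0 -> (size p <= k)%N.
Proof.
elim: k p => [|k IH] p; first by move=> /= ->; rewrite size_poly0.
rewrite iterSr => /IH /= Hk.
by apply: leq_trans (size_poly_backward_diff p) _.
Qed.

Lemma poly_eq0_ge p (n : nat) :
  (forall t : nat, (n < t)%N -> p.[t%:R] = 0) -> p = 0.
Proof.
move=> p0; apply/eqP/contraT => pn0.
pose rs := [seq (n + k).+1%:R : R | k <- iota 0 (size p)].
have prs : all (root p) rs.
  by apply/allP => _ /mapP[k _ ->]; rewrite /root p0 // ltnS leq_addr.
have : uniq rs.
  rewrite map_inj_uniq ?iota_uniq // => i j /eqP.
  by rewrite eqr_nat eqSS eqn_add2l => /eqP.
by move/(max_poly_roots pn0 prs); rewrite size_map size_iota ltnn.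
Qed.

(* Comparing [f] with its polynomial continuation [L]: their difference lives
   on [t <= 0], where [f] is known. *)
Lemma backward_diff_continuation d f (L : {poly R}) :
  (forall t, t < 0 -> f t = 0) ->
  (forall t : nat, (0 < t)%N -> f t = L.[t%:R]) ->
  (forall t, d%:Z < t -> iter d.+1 backward_diff f t = 0) ->
  (size L <= d.+1)%N /\
  iter d.+1 backward_diff f (d%:Z - 1) =
    (-1) ^+ d * (L.[- 2] - d.+1%:R * L.[- 1]).
Proof.
move=> f0 fL fd.
pose g t := f t - L.[t%:~R].
have g_pos t : 0 < t -> g t = 0.
  by case: t => // t t0; rewrite /g fL // subrr.
have Dg t : iter d.+1 backward_diff g t = iter d.+1 backward_diff f t
    - (iter d.+1 poly_backward_diff L).[t%:~R].
  by rewrite iter_backward_diffB horner_poly_backward_diff.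
have [H0 H1 _] := iter_backward_diff_top d.+1 g_pos.
(* Beyond [d.+1] the differences of both [f] and [g] vanish, hence so does that of [L]. *)
have L0 : iter d.+1 poly_backward_diff L = 0.
  apply: (@poly_eq0_ge _ d.+1) => t dt.
  have := Dg t; rewrite H0 ?fd ?sub0r ?add0r; [|lia|lia].
  by move/esym/eqP; rewrite oppr_eq0 => /eqP.
split; first exact: size_iter_poly_backward_diff.
have {}Dg t : iter d.+1 backward_diff g t = iter d.+1 backward_diff f t.
  by rewrite Dg L0 horner0 subr0.
(* At [d.+1] the difference of [g] is its value at 0 up to sign, while that of [f] is 0. *)
have g0 : g 0 = 0.
  move: H1; rewrite Dg fd; last lia.
  by move/esym/eqP; rewrite mulf_eq0 signr_eq0 => /eqP.
have g_ge0 t : -1 < t -> g t = 0.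
  by move=> t1; have [->//|t0] := eqVneq t 0; apply: g_pos; lia.
(* Now [g] vanishes above -1, so its difference at [d - 1] involves only -1 and -2, where [f] is 0
   and [g] is [- L]. *)
have [_ _] := iter_backward_diff_top d.+1 g_ge0.
have -> : -1 + d.+1%:Z - 1 = d%:Z - 1 by lia.
rewrite Dg => ->; rewrite /g !f0 // !sub0r exprS.
have -> : (-1 - 1 : int) = - 2 by [].
have -> : (-1)%:~R = -1 :> R by [].
have -> : (-2)%:~R = -2 :> R by [].
by ring.
Qed.

Lemma ehrhart_ineq_coef_sum d (L : {poly R}) : (size L <= d.+1)%N ->
  \sum_(k < d.+1) ehrhart_ineq_coef R d k * L`_k =
  (-1) ^+ d * (L.[- 2] - d.+1%:R * L.[- 1]).
Proof.
move=> sL; rewrite !(horner_coef_wide _ sL) mulr_sumr -sumrB mulr_sumr.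
apply: eq_bigr => k _.
have -> : ehrhart_ineq_coef R d k = (-1) ^+ d * ((-2) ^+ k - d.+1%:R * (-1) ^+ k).
  rewrite /ehrhart_ineq_coef -natr1 (exprNn 2) -(signr_odd _ k) exprS.
  have [->|k0] := eqVneq (k : nat) 0%N; first by rewrite /= expr0; ring.
  by case: (odd k); rewrite ?expr0 ?expr1; ring.
by ring.
Qed.

End BackwardDifference.

(** * Lattice points in half-open cells *)

Section Cardinality.
Variables (T : choiceType).
Implicit Types (A C : set T).

Definition card A : nat := #|` fset_set A|%fset.

Lemma card_set0 : card classical_sets.set0 = 0%N.
Proof. by rewrite /card fset_set0 cardfs0. Qed.

Lemma card_sub A C : finite_set C -> (A `<=` C)%classic ->
  card A = (\sum_(z <- fset_set C) (z \in A))%N.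
Proof.
move=> finC AC; have finA := sub_finite_set AC finC.
rewrite -big_mkcond /= big_fset_condE /= -card_fset_sum1 /card; congr #|` _|.
apply/fsetP => z; rewrite !inE /= !in_fset_set // andb_idl // !inE.
exact: AC.
Qed.

(** Double counting: after exchanging the sums, each point of [C] is counted by exactly one
    [F i]. *)
Lemma card_partition (I : finType) (D : pred I) (F : I -> set T) C :
  finite_set C -> (forall i, D i -> (F i `<=` C)%classic) ->
  (forall z, C z -> exists2 i, D i & F i z) ->
  (forall i j z, D i -> D j -> F i z -> F j z -> i = j) ->
  card C = (\sum_(i | D i) card (F i))%N.
Proof.
move=> finC FC CF Funiq; have CC : (C `<=` C)%classic by [].
under [RHS]eq_bigr => i Di do rewrite (card_sub finC (FC i Di)).
rewrite exchange_big (card_sub finC CC) /= 2!big_seq.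
apply: eq_bigr => z; rewrite in_fset_set // => zC; rewrite zC.
have [i Di Fiz] : exists2 i, D i & F i z by apply: CF; move: zC; rewrite inE.
rewrite (bigD1 i) //= mem_set // big1 // => j /andP[Dj ji].
rewrite memNset // => Fjz; case/eqP: ji; exact: Funiq Fjz Fiz.
Qed.

Lemma card_split A (B : set T) : finite_set A ->
  card A = (card (A `&` B)%classic + card (A `&` ~` B)%classic)%N.
Proof.
move=> finA.
pose F (b : bool) := if b then (A `&` B)%classic else (A `&` ~` B)%classic.
rewrite (@card_partition bool predT F) //.
- by rewrite big_bool.
- by case=> _ z [].
- by move=> z Az; have [Bz|nBz] := pselect (B z); [exists true|exists false].
- by case; case=> // z _ _ [_ ?] [_ ?].
Qed.

Lemma card_image (U : choiceType) (f : T -> U) A : injective f ->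
  finite_set A -> #|` fset_set (f @` A)%classic|%fset = card A.
Proof. by move=> injf finA; rewrite fset_set_image // card_imfset. Qed.

End Cardinality.

Lemma finite_int_box d (b : nat) :
  finite_set [set z : 'rV[int]_d | forall j, `|z 0 j| <= b%:Z].
Proof.
pose F (u : 'rV['I_(b + b).+1]_d) : 'rV[int]_d :=
  map_mx (fun k : 'I_(b + b).+1 => (k : nat)%:Z - b%:Z) u.
apply: (@sub_finite_set _ _ (F @` setT)%classic); last first.
  exact: finite_image.
move=> z /= zb; exists (\row_j inord `|z 0 j + b%:Z|) => //.
apply/rowP => j; rewrite !mxE inordK; have := zb j; lia.
Qed.

Section LatticePoints.
Variables (R : realType) (d m : nat) (v : 'I_m -> 'rV[int]_d).

Definition homogenize (t : int) (z : 'rV[int]_d) : 'rV[R]_(1 + d) :=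
  row_mx (t%:~R)%:M (map_mx intr z).

Definition generators : 'M[R]_(m, 1 + d) := \matrix_i homogenize 1 (v i).

Definition height : 'cV[R]_(1 + d) := col_mx 1%:M 0.

(** Real coefficients give all lattice points of the cone at height [t], not only those in the
    semigroup of the generators. Heights are integers so that differences can reach below 0. *)
Definition cone_slice (t : int) : set 'rV[int]_d :=
  [set z | exists2 a : 'rV[R]_m, (forall i, 0 <= a 0 i) &
     a *m generators = homogenize t z].

Lemma row_generators i : row i generators = homogenize 1 (v i).
Proof. exact: rowK. Qed.

Lemma homogenizeB t s y z :
  homogenize (t - s) (y - z) = homogenize t y - homogenize s z.
Proof.
rewrite /homogenize opp_row_mx add_row_mx; congr row_mx.
  by rewrite rmorphB /= raddfB.
by rewrite map_mxB.
Qed.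

Lemma homogenize_height t z : (homogenize t z *m height) 0 0 = t%:~R.
Proof. by rewrite mul_row_col mulmx0 addr0 mulmx1 mxE eqxx. Qed.

Lemma generators_height : generators *m height = const_mx 1.
Proof.
apply/matrixP => i j; rewrite ord1 [RHS]mxE.
have -> : (generators *m height) i 0 = (row i generators *m height) 0 0.
  by rewrite -row_mul [RHS]mxE.
by rewrite row_generators homogenize_height.
Qed.

Lemma weight_height (a : 'rV[R]_m) t z : a *m generators = homogenize t z ->
  \sum_i a 0 i = t%:~R.
Proof.
move=> aV; rewrite -(homogenize_height t z) -aV -mulmxA generators_height mxE.
by apply: eq_bigr => i _; rewrite mxE mulr1.
Qed.

Lemma cone_slice_neg t : t < 0 -> cone_slice t = classical_sets.set0.
Proof.
move=> t0; rewrite -subset0 => z [a a0 /weight_height Ea].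
have : 0 <= t%:~R :> R by rewrite -Ea sumr_ge0.
by rewrite ler0z leNgt t0.
Qed.

(** The coefficients sum to [t], so every coordinate is at most [t] times a common bound on the
    generators. *)
Lemma finite_cone_slice t : finite_set (cone_slice t).
Proof.
pose b := (\sum_i \sum_j `|v i 0%R j|)%N.
apply: (@sub_finite_set _ _ _ _ (finite_int_box d (`|t| * b))).
move=> z [a a0 aV] j; have sum_a := weight_height aV.
rewrite -(ler_int R) intr_norm.
have -> : (z 0 j)%:~R = \sum_i a 0 i * (v i 0 j)%:~R.
  have := congr1 (fun x : 'rV[R]_(1 + d) => x 0 (rshift 1 j)) aV.
  rewrite [homogenize t z _ _]row_mxEr [RHS]mxE => <-; rewrite mxE.
  by apply: eq_bigr => i _; rewrite mxE row_mxEr mxE.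
apply: le_trans (ler_norm_sum _ _ _) _.
have vb i : `|(v i 0 j)%:~R| <= b%:R :> R.
  rewrite -intr_norm -abszE -[_%:~R]/((absz (v i 0 j))%:R) ler_nat /b.
  by rewrite (bigD1 i) //= (bigD1 j) //= -addnA leq_addr.
apply: (@le_trans _ _ (\sum_i a 0 i * b%:R)).
  by apply: ler_sum => i _; rewrite normrM ger0_norm // ler_wpM2l.
rewrite -mulr_suml sum_a PoszM intrM ler_wpM2r ?ler0n //.
by rewrite ler_int; lia.
Qed.

Hypothesis full : row_full generators.

(** * Counting in half-open cells by successive differences *)

Section Cells.
Variables (w : 'cV[R]_m) (q : 'rV[R]_(1 + d)).
Hypothesis w_generic : forall S k, is_basis generators S -> k \notin S ->
  (row k generators *m coords generators S *m w) 0 0 != w k 0.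
Hypothesis q_generic : forall S i, is_basis generators S -> i \in S ->
  (q *m coords generators S) 0 i != 0.
Hypothesis q_cone : exists2 u : 'rV[R]_m, (forall i, 0 <= u 0 i) & u *m generators = q.
Hypothesis q_pos : 0 < (q *m height) 0 0.

Local Notation coordsV := (coords generators).
Local Notation insideV := (inside generators q).

(* Points of the half-open cone over the cell [S] from which, for [i \in J],
   the [i]-th generator cannot be subtracted; [J = S] gives the lattice points
   of the half-open fundamental parallelepiped. *)
Definition half_open (S J : {set 'I_m}) (t : int) : set 'rV[int]_d :=
  [set z | (forall i, i \in S -> insideV S i (homogenize t z)) /\
    (forall i, i \in J -> ~~ insideV S i (homogenize (t - 1) (z - v i)))].

Lemma half_open_cone S J t : is_basis generators S ->
  (half_open S J t `<=` cone_slice t)%classic.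
Proof.
move=> bS z [Sz _]; exists (homogenize t z *m coordsV S); last exact: coordsK.
move=> i; have [iS|iS] := boolP (i \in S).
  exact: inside_ge0 (Sz i iS).
by rewrite coords_supported.
Qed.

Lemma inside_shift S i j t z : is_basis generators S -> i \in S -> j != i ->
  insideV S j (homogenize (t - 1) (z - v i)) = insideV S j (homogenize t z).
Proof.
move=> bS iS ji; rewrite /inside homogenizeB -row_generators.
by rewrite !coords_subr // (negPf ji) subr0.
Qed.

Lemma inside_shift_le S i t z : is_basis generators S -> i \in S ->
  insideV S i (homogenize (t - 1) (z - v i)) -> insideV S i (homogenize t z).
Proof.
move=> bS iS /inside_ge0; rewrite /inside homogenizeB -row_generators.
rewrite coords_subr // eqxx subr_ge0 => c1.
by rewrite (lt_le_trans ltr01 c1).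
Qed.

(** Split the points by whether the [i]-th generator can be subtracted. Those where it can are the
    translates by [v i] of the points one level below; the others satisfy the extra condition at
    [i]. *)
Lemma half_openU1 S (J : {set 'I_m}) i t : is_basis generators S ->
  J \subset S -> i \in S -> i \notin J ->
  card (half_open S J t) =
    (card (half_open S J (t - 1)) + card (half_open S (i |: J) t))%N.
Proof.
move=> bS JS iS iJ; have finJ s := sub_finite_set (@half_open_cone S J s bS) (finite_cone_slice s).
rewrite (card_split [set z | insideV S i (homogenize (t - 1) (z - v i))] (finJ t)).
congr addn.
  rewrite -(@card_image _ _ (fun z => z + v i) (half_open S J (t - 1)) (@addIr _ _) (finJ _)).
  rewrite /card; congr #|` fset_set _|; apply/seteqP; split => z /=.
    case=> [[Sz Jz] iz]; exists (z - v i); last by rewrite subrK.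
    split=> j jX.
      by have [->//|ji] := eqVneq j i; rewrite inside_shift ?Sz.
    have ji : j != i by apply: contraNneq iJ => <-.
    by rewrite (addrAC z) inside_shift // Jz.
  case=> y [Sy Jy] <-.
  have E k : insideV S k (homogenize (t - 1) (y + v i - v i)) = insideV S k (homogenize (t - 1) y).
    by rewrite addrK.
  split; last by rewrite E Sy.
  split=> j jX.
    have [->|ji] := eqVneq j i; first by apply: inside_shift_le => //; rewrite E Sy.
    by rewrite -(@inside_shift S i) // E Sy.
  have ji : j != i by apply: contraNneq iJ => <-.
  by rewrite -(@inside_shift S i) // [_ - v j]addrAC addrK Jy.
rewrite /card; congr #|` fset_set _|; apply/seteqP; split => z /=.
  case=> [[Sz Jz] iz]; split=> // j; rewrite !inE => /orP[/eqP->|]; last exact: Jz.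
  exact/negP.
case=> Sz Jz; split; last by apply/negP; apply: Jz; rewrite !inE eqxx.
by split=> // j jJ; apply: Jz; rewrite !inE jJ orbT.
Qed.

Lemma iter_backward_diff_half_open S (J : {set 'I_m}) t :
  is_basis generators S -> J \subset S ->
  iter #|J| (@backward_diff R) (fun s => (card (half_open S finset.set0 s))%:R) t =
  (card (half_open S J t))%:R.
Proof.
move=> bS; have [k] := ubnP #|J|; elim: k J t => // k IH J t Jk JS.
have [->|[i iJ]] := set_0Vmem J; first by rewrite cards0.
have JiS : J :\ i \subset S by apply: fintype.subset_trans JS; exact: subD1set.
have Jik : (#|J :\ i| < k)%N by rewrite (cardsD1 i) iJ in Jk.
rewrite (cardsD1 i J) iJ add1n iterS /backward_diff !IH //.
rewrite (@half_openU1 S (J :\ i) i t) ?inE ?eqxx //; last exact: (fintype.subsetP JS).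
by rewrite natrD addrC addKr finset.setD1K.
Qed.

(** The [d + 1] coordinates are at most 1 and sum to [t], so [t > d] forces them all to be 1. A
    coordinate equal to 1 requires that of [q] to be nonpositive, contradicting the positive height
    of [q]. *)
Lemma half_open_parallelepiped S t : is_basis generators S -> d%:Z < t ->
  half_open S S t = classical_sets.set0.
Proof.
move=> bS dt; rewrite -subset0 => z [Sz Jz].
pose c := homogenize t z *m coordsV S.
have sum_c (y : 'rV[R]_(1 + d)) : \sum_(i in S) (y *m coordsV S) 0 i = (y *m height) 0 0.
  rewrite -{2}(coordsK y bS) -mulmxA generators_height mxE big_mkcond.
  apply: eq_bigr => i _; rewrite [const_mx _ _ _]mxE mulr1.
  by case: ifPn => // iS; rewrite coords_supported.
have Jc i : i \in S -> ((c 0 i < 1) || (c 0 i == 1) && ((q *m coordsV S) 0 i <= 0)).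
  move=> iS; have := Jz i iS; rewrite /inside homogenizeB -row_generators.
  rewrite coords_subr // eqxx subr_gt0 subr_eq0 negb_or negb_and -!leNgt /c.
  by case: ltgtP.
have c1 i : i \in S -> c 0 i <= 1 by move=> /Jc; case: ltgtP.
have H : \sum_(i in S) (1 - c 0 i) = d.+1%:R - t%:~R.
  by rewrite sumrB /c sum_c homogenize_height sumr_const (card_basis bS).
have H0 : \sum_(i in S) (1 - c 0 i) = 0.
  apply/le_anti/andP; split; last by apply: sumr_ge0 => i /c1; rewrite subr_ge0.
  by rewrite H subr_le0 -[d.+1%:R]/(d.+1%:Z%:~R) ler_int; lia.
have : (q *m height) 0 0 <= 0.
  rewrite -sum_c; apply: sumr_le0 => i iS; have := Jc i iS.
  move/eqP: H0; rewrite psumr_eq0 => [/allP/(_ i (mem_index_enum i))|j /c1]; last by rewrite subr_ge0.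
  by rewrite iS subr_eq0 eq_sym => /eqP ->; rewrite ltxx eqxx.
by rewrite leNgt q_pos.
Qed.

Lemma card_cone_slice t : card (cone_slice t) =
  (\sum_(S | cell generators w S) card (half_open S finset.set0 t))%N.
Proof.
apply: card_partition.
- exact: finite_cone_slice.
- by move=> S /andP[bS _]; apply: half_open_cone.
- move=> z [a a0 aV].
  have [S cS Sz] := cell_exists generators_height full w_generic q_generic q_cone a0 aV.
  by exists S => //; split=> // i; rewrite inE.
- move=> S S' z cS cS' [Sz _] [S'z _].
  exact (cell_unique q_generic cS cS' Sz S'z).
Qed.

Lemma iter_backward_diff_cone_slice t :
  iter d.+1 (@backward_diff R) (fun s => (card (cone_slice s))%:R) t =
  \sum_(S | cell generators w S) (card (half_open S S t))%:R.
Proof.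
have E k s : iter k (@backward_diff R) (fun s => (card (cone_slice s))%:R) s =
    \sum_(S | cell generators w S)
      iter k (@backward_diff R) (fun s => (card (half_open S finset.set0 s))%:R) s.
  elim: k s => [|k IH] s /=; first by rewrite card_cone_slice natr_sum.
  by rewrite /backward_diff !IH sumrB.
rewrite E; apply: eq_bigr => S /andP[bS _].
by rewrite -[d.+1](card_basis bS) iter_backward_diff_half_open.
Qed.

End Cells.

Lemma cone_slice_diff :
  (forall t, 0 <= iter d.+1 (@backward_diff R) (fun s => (card (cone_slice s))%:R) t) /\
  (forall t, d%:Z < t ->
    iter d.+1 (@backward_diff R) (fun s => (card (cone_slice s))%:R) t = 0).
Proof.
have [w [w0 w_gen q_gen]] := generic_cost generators.
have q_cone : exists2 u : 'rV[R]_m, (forall i, 0 <= u 0 i) &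
    u *m generators = w^T *m generators.
  by exists w^T => // i; rewrite mxE ltW.
have q_pos : 0 < (w^T *m generators *m height) 0 0.
  rewrite -mulmxA generators_height mxE.
  (* Full rank forces at least one generator, so the sum of the weights is positive. *)
  have [i _] : exists i : 'I_m, true.
    apply: contrapT => noi; have : (1 + d <= m)%N by rewrite -(eqP full) rank_leq_row.
    by case: (m) noi => // k []; exists ord0.
  rewrite (bigD1 i) //= ltr_wpDr ?sumr_ge0 // => [j _|]; rewrite !mxE mulr1 ?w0 //.
  exact: ltW.
have E := iter_backward_diff_cone_slice w_gen q_gen q_cone.
split=> t; first by rewrite E sumr_ge0.
move=> dt; rewrite E big1 // => S /andP[bS _].
by rewrite half_open_parallelepiped // card_set0.
Qed.

End LatticePoints.

(** * Polytopes as hulls of their vertices *)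

Section Hull.
Variables (R : realType) (d m : nat) (W : 'M[R]_(m, d)).
Implicit Types (S : {set 'I_m}) (a : 'rV[R]_m).

(** Coefficients are always indexed by all rows, so that dropping a generator only restricts the
    support. *)
Definition hull S : set 'rV[R]_d :=
  [set x | exists a, [/\ forall i, 0 <= a 0 i, supported S a,
     \sum_i a 0 i = 1 & a *m W = x]].

Lemma convex_hull_rows (V : set 'rV[R]_d) : (forall i, V (row i W)) ->
  (forall x, V x -> exists i, x = row i W) -> convex_hull V = hull [set: 'I_m].
Proof.
move=> VW WV; apply/seteqP; split=> x.
  move=> [n [u [b [uV b0 b1 ->]]]].
  have [f fu] := choice (fun k => WV _ (uV k)).
  exists (\sum_k b k *: delta_mx 0 (f k)); split.
  - move=> i; rewrite summxE sumr_ge0 // => k _.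
    by rewrite !mxE mulr_ge0 ?ler0n.
  - by move=> i; rewrite inE.
  - under eq_bigr do rewrite summxE.
    rewrite exchange_big -[RHS]b1; apply: eq_bigr => k _.
    rewrite (bigD1 (f k)) //= !mxE !eqxx mulr1 big1 ?addr0 // => i ik.
    by rewrite !mxE (negPf ik) andbF mulr0.
  - rewrite mulmx_suml; apply: eq_bigr => k _.
    by rewrite -scalemxAl -rowE -fu.
move=> [a [a0 _ a1 <-]]; exists m, (fun i => row i W), (a 0); split=> //.
exact: mulmx_sum_row.
Qed.

(** If row [i] lies between two points of the hull, average their coefficients to get [c]. Either
    [c] has weight 1 at [i] and both points are row [i], or removing that weight and rescaling puts
    row [i] in the hull of the others. *)
Lemma hull_extreme S i : i \in S ->
  ~ hull (S :\ i) (row i W) -> is_vertex (hull S) (row i W).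
Proof.
move=> iS nSi; split.
  exists (delta_mx 0 i); split; last by rewrite -rowE.
  - by move=> j; rewrite mxE ler0n.
  - by move=> j; rewrite mxE /=; case: eqP => // ->; rewrite iS.
  - rewrite (bigD1 i) //= mxE !eqxx big1 ?addr0 // => j ji.
    by rewrite mxE (negPf ji) andbF.
move=> _ _ s [a [a0 aS a1 <-]] [b [b0 bS b1 <-]] /andP[s0 s1] E.
have le1 (u : 'rV[R]_m) : (forall j, 0 <= u 0 j) -> \sum_j u 0 j = 1 -> u 0 i <= 1.
  by move=> u0 <-; rewrite (bigD1 i) //= lerDl sumr_ge0.
have eq_delta (u : 'rV[R]_m) : (forall j, 0 <= u 0 j) -> \sum_j u 0 j = 1 ->
    u 0 i = 1 -> u *m W = row i W.
  move=> u0 u1 ui; rewrite rowE; congr (_ *m _); apply/rowP => j; rewrite mxE /=.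
  have [->|ji] := eqVneq j i; first exact: ui.
  move/eqP: u1; rewrite (bigD1 i) //= ui -subr_eq0 addrAC subrr add0r.
  by rewrite psumr_eq0 // => /allP/(_ j (mem_index_enum j)); rewrite ji => /eqP.
pose c := s *: a + (1 - s) *: b.
have c0 j : 0 <= c 0 j by rewrite !mxE addr_ge0 ?mulr_ge0 // ?subr_ge0 ltW.
have cS j : j \notin S -> c 0 j = 0.
  by move=> jS; rewrite !mxE (aS j jS) (bS j jS) !mulr0 addr0.
have cW : c *m W = row i W by rewrite E mulmxDl -!scalemxAl.
have c1 : \sum_j c 0 j = 1.
  under eq_bigr do rewrite !mxE.
  by rewrite big_split /= -!mulr_sumr a1 b1 !mulr1 addrC subrK.
have [ci|ci] := eqVneq (c 0 i) 1.
  have : s * (1 - a 0 i) + (1 - s) * (1 - b 0 i) = 0.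
    by move: ci; rewrite !mxE; lra.
  have s1' : 0 < 1 - s by rewrite subr_gt0.
  move/eqP; rewrite paddr_eq0 ?mulr_ge0 ?subr_ge0 ?le1 ?(ltW s0) ?(ltW s1) //.
  rewrite !mulf_eq0 (gt_eqF s0) (gt_eqF s1') /= !subr_eq0.
  by case/andP => /eqP ai /eqP bi; rewrite !eq_delta.
pose e : 'rV[R]_m := c - c 0 i *: delta_mx 0 i.
have eE j : e 0 j = c 0 j * (j != i)%:R.
  rewrite mxE [X in _ + X]mxE [X in _ - X]mxE [delta_mx _ _ _ _]mxE /=.
  by have [->|_] := eqVneq j i; rewrite ?mulr1 ?mulr0 ?subrr ?subr0.
have ci1 : 0 < 1 - c 0 i by rewrite subr_gt0 lt_neqAle ci le1.
case: nSi; exists ((1 - c 0 i)^-1 *: e); split.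
- by move=> j; rewrite mxE eE !mulr_ge0 ?invr_ge0 ?(ltW ci1) ?ler0n.
- move=> j; rewrite !inE negb_and negbK mxE eE.
  have [->|_ jS] := eqVneq j i; first by rewrite !mulr0.
  by rewrite (cS j jS) mul0r mulr0.
- under eq_bigr do rewrite mxE eE.
  rewrite -mulr_sumr; move: c1; rewrite (bigD1 i) //= => c1.
  rewrite (bigD1 i) //= eqxx mulr0 add0r.
  under eq_bigr => j ji do rewrite ji mulr1.
  have -> : \sum_(j | j != i) c 0 j = 1 - c 0 i.
    by apply/eqP; rewrite eq_sym subr_eq addrC c1.
  by rewrite mulVf // gt_eqF.
- rewrite -scalemxAl mulmxBl -scalemxAl cW -rowE -{1}[row i W]scale1r -scalerBl.
  by rewrite scalerA mulVf ?scale1r // gt_eqF.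
Qed.

Lemma hull_drop S i : hull (S :\ i) (row i W) -> hull (S :\ i) = hull S.
Proof.
move=> [c [c0 cS c1 cW]]; apply/seteqP; split=> x [a [a0 aS a1 <-]].
  by exists a; split=> // j jS; apply: aS; rewrite !inE (negPf jS) andbF.
(* The weight at [i] is redistributed according to [c], which represents row [i]. *)
exists (a - a 0 i *: delta_mx 0 i + a 0 i *: c); split.
- move=> j; rewrite !mxE /=; apply: addr_ge0; last exact: mulr_ge0.
  by have [->|_] := eqVneq j i; rewrite ?mulr1 ?subrr // mulr0 subr0.
- move=> j jS; rewrite !mxE cS // mulr0 addr0 /=.
  have [->|ji] := eqVneq j i; first by rewrite mulr1 subrr.
  by rewrite mulr0 subr0 aS //; move: jS; rewrite !inE ji.
- under eq_bigr do rewrite !mxE /=.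
  rewrite big_split sumrB /= -!mulr_sumr c1 a1.
  rewrite (bigD1 i) //= eqxx big1 => [|j /negPf->//].
  by rewrite addr0 mulr1 subrK.
- by rewrite mulmxDl mulmxBl -!scalemxAl -rowE cW subrK.
Qed.

(** In a minimal generating subset no row is redundant, so each one is a vertex by
    [hull_extreme]. *)
Lemma hull_vertices : exists2 S, hull S = hull [set: 'I_m] &
  forall i, i \in S -> is_vertex (hull [set: 'I_m]) (row i W).
Proof.
pose good (S : {set 'I_m}) := `[< hull S = hull [set: 'I_m] >].
have [S /minsetP[/asboolP hS minS] _] : {S : {set 'I_m} | minset good S & S \subset [set: 'I_m]}.
  by apply: minset_exists; apply/asboolP.
exists S => // i iS; rewrite -hS; apply: hull_extreme => // /hull_drop hSi.
have /minS : good (S :\ i) by apply/asboolP; rewrite hSi.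
move=> /(_ (subsetDl _ _)) /setP/(_ i); rewrite !inE eqxx iS //.
Qed.

End Hull.

(** * Lattice polytopes and the cones over them *)

Section LatticePolytope.
Variables (R : realType) (d : nat).

Lemma polytope_rows (P : set 'rV[R]_d) : convex_polytope P ->
  exists m (W : 'M[R]_(m, d)), P = hull W [set: 'I_m].
Proof.
move=> [V finV ->]; pose X := fset_set V.
have VX x : x \in X -> V x by rewrite in_fset_set // inE.
exists #|` X|%fset, (\matrix_(i < #|` X|%fset) (nth 0 X i)).
apply: convex_hull_rows => [i|x Vx].
  by rewrite rowK; apply: VX; rewrite mem_nth.
have xX : x \in X by rewrite in_fset_set // inE.
have lt_xX : (index x X < #|` X|%fset)%N by rewrite index_mem.
by exists (Ordinal lt_xX); rewrite rowK nth_index.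
Qed.

(** This discards the rows outside [S] without changing [m]: their indices are redirected into [S],
    repeating rows. *)
Lemma hull_relabel m (W : 'M[R]_(m, d)) (S : {set 'I_m}) (f : 'I_m -> 'I_m) :
  (forall i, f i \in S) -> (forall i, i \in S -> f i = i) ->
  hull W S = hull (\matrix_i row (f i) W) [set: 'I_m].
Proof.
move=> fS fE; pose F : 'M[R]_m := \matrix_i delta_mx 0 (f i).
have WF : \matrix_i row (f i) W = F *m W.
  by apply/row_matrixP => i; rewrite row_mul !rowK -rowE.
have sumF (a : 'rV[R]_m) : \sum_j (a *m F) 0 j = \sum_i a 0 i.
  under eq_bigr do rewrite mxE.
  rewrite exchange_big; apply: eq_bigr => i _ /=.
  rewrite (bigD1 (f i)) //= !mxE !eqxx mulr1 big1 ?addr0 // => j ji.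
  by rewrite !mxE (negPf ji) andbF mulr0.
apply/seteqP; split=> x [a [a0 aS a1 <-]].
  exists a; split=> // [i|]; first by rewrite inE.
  rewrite WF mulmxA; congr (_ *m _); rewrite -[RHS]mulmx1 !mulmx_sum_row.
  apply: eq_bigr => i _; have [iS|/aS->] := boolP (i \in S); last by rewrite !scale0r.
  by rewrite rowK row1 fE.
exists (a *m F); rewrite WF sumF mulmxA; split=> // j.
  by rewrite mxE sumr_ge0 // => i _; rewrite !mxE mulr_ge0 ?ler0n.
move=> jS; rewrite mxE big1 // => i _; rewrite !mxE /=.
by case: eqP jS => [->|]; rewrite ?fS ?mulr0.
Qed.

Lemma lattice_polytope_hull (P : set 'rV[R]_d) :
  lattice_polytope P -> (exists x, P x) ->
  exists m (v : 'I_m -> 'rV[int]_d),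
    P = hull (\matrix_i real_point R (v i)) [set: 'I_m].
Proof.
move=> [/polytope_rows[m [W PW]] Pv] [x Px].
have [S hS Svertex] := hull_vertices W.
have [i0 i0S] : exists i, i \in S.
  move: Px; rewrite PW -hS => -[a [_ aS a1 _]]; apply: contrapT => noS.
  have := oner_neq0 R; rewrite -a1 big1 ?eqxx // => i _.
  by apply: aS; apply/negP => iS; apply: noS; exists i.
have [z zP] : {z : 'I_m -> 'rV[int]_d & forall i, i \in S -> real_point R (z i) = row i W}.
  apply: (@choice _ _ (fun i y => i \in S -> real_point R y = row i W)) => i.
  have [iS|iS] := boolP (i \in S); last by exists 0.
  have /Pv[y _ yE] : is_vertex P (row i W) by rewrite PW; apply: Svertex.
  by exists y.
pose f i := if i \in S then i else i0.
have fS i : f i \in S by rewrite /f; case: ifP.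
exists m, (z \o f); rewrite PW -hS (@hull_relabel _ _ _ f) // => [|i iS]; last by rewrite /f iS.
by congr (hull _ _); apply/row_matrixP => i; rewrite !rowK /= zP.
Qed.

Lemma affine_hull_full (P : set 'rV[R]_d) : has_dim P d -> affine_hull P = setT.
Proof.
move=> [p [U [-> dU]]]; have Ufull : U = fullv.
  by apply/eqP; rewrite eqEdim subvf dU dimvf /dim /= mul1n leqnn.
rewrite -subTset => x _; exists (x - p); last by rewrite addrC subrK.
by rewrite /= Ufull memvf.
Qed.

Section Generators.
Variables (m : nat) (v : 'I_m -> 'rV[int]_d).
Let W : 'M[R]_(m, d) := \matrix_i real_point R (v i).

Lemma mul_generators (a : 'rV[R]_m) :
  a *m generators R v = row_mx (\sum_i a 0 i)%:M (a *m W).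
Proof.
have -> : generators R v = row_mx (const_mx 1) W.
  apply/row_matrixP => i; rewrite row_row_mx !rowK; congr row_mx.
  by apply/matrixP => j k; rewrite !ord1 !mxE.
rewrite mul_mx_row; congr row_mx; apply/matrixP => i j; rewrite !ord1 !mxE eqxx.
by apply: eq_bigr => k _; rewrite mxE mulr1.
Qed.

(** Affine combinations of points of the hull reach every [x], so the row space contains every
    vector with first coordinate 1, and these span the whole space. *)
Lemma generators_full : has_dim (hull W [set: 'I_m]) d -> row_full (generators R v).
Proof.
move=> /affine_hull_full hullT.
have sub1 x : (row_mx 1%:M x <= generators R v)%MS.
  have : affine_hull (hull W [set: 'I_m]) x by rewrite hullT.
  move=> [n [u [a [uP a1 ->]]]].
  have -> : row_mx 1%:M (\sum_i a i *: u i) = \sum_i a i *: row_mx (1%:M : 'M[R]_1) (u i).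
    under [RHS]eq_bigr do rewrite scale_row_mx.
    apply/rowP => j; rewrite summxE.
    case: (split_ordP j) => k ->.
      rewrite row_mxEl mxE ord1 eqxx; under eq_bigr do rewrite row_mxEl !mxE eqxx mulr1.
      by rewrite a1.
    by rewrite row_mxEr summxE; apply: eq_bigr => i _; rewrite row_mxEr.
  apply: summx_sub => i _; apply: scalemx_sub.
  have [b [_ _ b1 <-]] := uP i.
  by rewrite -b1 -mul_generators submxMl.
rewrite -sub1mx; apply/row_subP => i; set x := row i _.
have -> : x = row_mx 1%:M (rsubmx x) - row_mx 1%:M 0 + lsubmx x 0 0 *: row_mx 1%:M 0.
  rewrite -{1}(hsubmxK x) opp_row_mx add_row_mx subrr subr0 scale_row_mx scaler0.
  by rewrite add_row_mx add0r addr0 scalemx1 -mx11_scalar.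
by rewrite !addmx_sub ?scalemx_sub ?eqmx_opp.
Qed.

Lemma cone_slice_dilate (t : nat) : (0 < t)%N -> cone_slice R v t%:Z =
  [set z : 'rV[int]_d | dilate t (hull W [set: 'I_m]) (real_point R z)]%classic.
Proof.
move=> t0; have tR : t%:R != 0 :> R by rewrite pnatr_eq0 -lt0n.
apply/seteqP; split=> z /=.
  move=> [a a0]; rewrite mul_generators => /eq_row_mx[/matrixP/(_ 0 0) at_ az].
  move: at_; rewrite !mxE !eqxx !mulr1n => at_.
  exists (t%:R^-1 *: a *m W); last by rewrite -scalemxAl scalerA mulfV ?scale1r.
  exists (t%:R^-1 *: a); split=> // [i|i|].
  - by rewrite mxE mulr_ge0 ?invr_ge0 ?ler0n.
  - by rewrite inE.
  - under eq_bigr do rewrite mxE.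
    by rewrite -mulr_sumr at_ mulVf.
move=> [_ [a [a0 _ a1 <-]] az]; exists (t%:R *: a).
  by move=> i; rewrite mxE mulr_ge0 ?ler0n.
rewrite mul_generators -scalemxAl az /homogenize; congr row_mx.
under eq_bigr do rewrite mxE.
by rewrite -mulr_sumr a1 mulr1.
Qed.

End Generators.

End LatticePolytope.

Theorem theorem2 (R : realType) (d : nat) (d_gt0 : (0 < d)%N)
    (P : set 'rV[R]_d) (L : {poly R})
    (P_lattice : lattice_polytope P) (P_dim : has_dim P d)
    (L_ehrhart : ehrhart_polynomial P L) :
  0 <= \sum_(k < d.+1) ehrhart_ineq_coef R d k * L`_k.
Proof.
have P0 : (exists x, P x).
  (* The affine hull is the whole space, and an affine combination giving 0 has at least one point,
     its weights summing to 1. *)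
  have : affine_hull P 0 by rewrite affine_hull_full.
  move=> [n [u [a [uP a1 _]]]]; case: n u a uP a1 => [u a _|n u a uP _].
    by rewrite big_ord0 => /esym/eqP; rewrite oner_eq0.
  by exists (u ord0); apply: uP.
have [m [v PE]] := lattice_polytope_hull P_lattice P0.
rewrite PE in P_dim L_ehrhart.
have [f_ge0 f_vanish] := cone_slice_diff (generators_full P_dim).
have [||sL E] := backward_diff_continuation (L := L) _ _ f_vanish.
- by move=> t t0; rewrite cone_slice_neg // card_set0.
- by move=> t t0; rewrite L_ehrhart // /lattice_count cone_slice_dilate.
by rewrite ehrhart_ineq_coef_sum // -E.
Qed.
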